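(* Let $F$ be an iterated function system on $\mathbb{R}^d$ whose maps all have the same contraction factor $r\in(0,1)$, and let $A$ be its attractor. (i) If $F$ is of finite type (i.e. there are finitely many proper neighbor maps), then for every $D>0$ there are only finitely many neighbor maps $h(x)=s(x)+v$ ($s$ a linear isometry, $v\in\mathbb{R}^d$) with $|v|\le D$. (ii) For any open set $V\supset A$ (with $f(V)\subset V$ for all $f\in F$, as required in the definition of neighbors with respect to $V$), the concept of finite type in terms of proper neighbor maps coincides with the finite type condition of Ngai and Wang with respect to $V$: $F$ is of finite type if and only if $F$ satisfies the finite type condition of Ngai and Wang with respect to $V$.
   Context: An iterated function system (IFS) $F$ on $\mathbb{R}^d$ is a finite set of contractive similarity maps; a contractive similitude $f$ satisfies $|f(x)-f(y)|=r_f|x-y|$ with a factor $r_f<1$, and here $r_f=r$ for all $f\in F$. The attractor of $F$ is the unique nonempty compact set $A$ with $A=\bigcup_{f\in F}f(A)$. Let $F^n$ be the set of all compositions of $n$ maps of $F$. A neighbor map (considered here as an isometry) is a map $h=f^{-1}g$ with $f,g\in F^n$ for some common $n\ge1$; it has the form $h(x)=s(x)+v$ with a linear isometry $s$ and a vector $v$. It is called proper if $A\cap h(A)\neq\emptyset$. $F$ is of finite type if it has finitely many proper neighbor maps. Let $V$ be an open set with $f(V)\subset V$ for all $f\in F$. Two maps $f,g\in F^n$ are neighbors with respect to $V$ if $f(V)\cap g(V)\neq\emptyset$. The finite type condition of Ngai and Wang with respect to $V$ says that, up to similarity, there are finitely many such neighbor configurations: the set of neighbor maps $\{f^{-1}g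 \mid f,g\in F^n,\ n\ge1,\ f(V)\cap g(V)\neq\emptyset\}$ is finite. (Counting neighborhoods instead of neighbors makes no difference for finiteness.)
   Formalization: In (ii), ''finite type implies Ngai–Wang with respect to V'' is proved for bounded V only; it fails for V = R with the Cantor system {x/3, (x+2)/3}. The converse is proved for every open V ⊃ A. *)

(* Defs.v *)
From HB Require Import structures.
From mathcomp Require Import all_boot all_order all_algebra.
From mathcomp Require Import all_classical all_reals all_analysis.
Set Implicit Arguments.
Unset Strict Implicit.
Unset Printing Implicit Defensive.
Import Order.TTheory GRing.Theory Num.Theory.
Import numFieldNormedType.Exports.
Local Open Scope classical_set_scope.
Local Open Scope ring_scope.

(* The library norm on 'rV[R]_d is the sup norm: it yields the usual topology
   and the usual bounded sets, but similarity maps and isometries must be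
   measured with the Euclidean norm. *)
Definition enorm (R : realType) (d : nat) (x : 'rV[R]_d) : R :=
  Num.sqrt (\sum_(i < d) x 0 i ^+ 2).

Definition similitude (R : realType) (d : nat) (r : R)
    (f : 'rV[R]_d -> 'rV[R]_d) : Prop :=
  forall x y, enorm (f x - f y) = r * enorm (x - y).

Definition is_ifs (R : realType) (d : nat) (r : R)
    (F : set ('rV[R]_d -> 'rV[R]_d)) : Prop :=
  finite_set F /\ forall f, F f -> similitude r f.

Definition is_attractor (R : realType) (d : nat)
    (F : set ('rV[R]_d -> 'rV[R]_d)) (A : set 'rV[R]_d) : Prop :=
  [/\ A !=set0, compact A & A = \bigcup_(f in F) (f @` A)].

Fixpoint compositions (T : Type) (F : set (T -> T)) (n : nat) : set (T -> T) :=
  if n is m.+1 then [set h | exists f g, [/\ F f, compositions F m g & h = f \o g]]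
  else [set id].

(* h = f^-1 \o g, for an invertible f *)
Definition is_lquotient (T : Type) (f g h : T -> T) : Prop :=
  exists finv : T -> T, [/\ cancel f finv, cancel finv f & h = finv \o g].

Definition neighbor_maps (T : Type) (F : set (T -> T)) : set (T -> T) :=
  [set h | exists n f g, [/\ (1 <= n)%N, compositions F n f,
                             compositions F n g & is_lquotient f g h]].

Definition finite_type (T : Type) (F : set (T -> T)) (A : set T) : Prop :=
  finite_set [set h | neighbor_maps F h /\ A `&` h @` A !=set0].

(* V need not be bounded here; with V the whole space every neighbor map counts,
   so equivalence with finite_type can only be expected for bounded V. *)
Definition ngai_wang (T : Type) (F : set (T -> T)) (V : set T) : Prop :=
  finite_set [set h | exists n f g,
    [/\ (1 <= n)%N, compositions F n f, compositions F n g,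
        f @` V `&` g @` V !=set0 & is_lquotient f g h]].

Definition linear_isometry (R : realType) (d : nat)
    (s : {linear 'rV[R]_d -> 'rV[R]_d}) : Prop :=
  forall x, enorm (s x) = enorm x.

(* Main.v *)
(** Write a neighbor map [h = f^-1 g] with [f = f' f1], [g = g' g1], where [f1]
    and [g1] are the innermost maps.  Then [h = f1^-1 h' g1] for the shorter
    neighbor map [h' = f'^-1 g'], and [dist(A, h A) >= dist(A, h' A) / r].  So
    along a chain [id = h_0, h_1, ..., h_n = h], once a map is improper all
    later ones are.  In the finite type case only finitely many maps can be the
    first improper one; by compactness each of them moves [A] away from itself
    by a positive distance, which then grows geometrically.  Hence a bound on
    [dist(A, h A)] bounds the number of steps after properness is lost, which
    leaves finitely many [h]. *)
Require Import Defs.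
From HB Require Import structures.
From mathcomp Require Import all_boot all_order all_algebra.
From mathcomp Require Import all_classical all_reals all_analysis.
Set Implicit Arguments.
Unset Strict Implicit.
Unset Printing Implicit Defensive.
Import Order.TTheory GRing.Theory Num.Theory.
Import numFieldNormedType.Exports.
Local Open Scope classical_set_scope.
Local Open Scope ring_scope.

(** * Euclidean norm, sup norm and similitudes *)

Lemma norm_le_enorm (R : realType) (d : nat) (x : 'rV[R]_d) : `|x| <= enorm x.
Proof.
have [x0|] := eqVneq (mx_norm x) 0.
  by rewrite /Num.norm/= x0 sqrtr_ge0.
move=> /mx_norm_neq0[[i j] /= xij]; rewrite /Num.norm/= xij ord1.
rewrite -sqrtr_sqr ler_wsqrtr// (bigD1 j)//= lerDl.
by apply: sumr_ge0 => k _; exact: sqr_ge0.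
Qed.

Lemma enorm_le_norm (R : realType) (d : nat) (x : 'rV[R]_d) :
  enorm x <= d%:R * `|x|.
Proof.
have xle j : `|x 0 j| <= `|x|.
  rewrite {2}/Num.norm/= mx_normrE.
  exact: (le_bigmax _ (fun ij => `|x ij.1 ij.2|) (0, j)).
rewrite -[leRHS]ger0_norm ?mulr_ge0// -sqrtr_sqr ler_wsqrtr//.
apply: (@le_trans _ _ (\sum_(i < d) `|x| ^+ 2)).
  apply: ler_sum => i _.
  by rewrite -real_normK ?num_real// lerXn2r ?nnegrE.
(* The factor [d] is cruder than its square root; after squaring, [d <= d ^ 2] suffices. *)
rewrite sumr_const card_ord exprMn -[leLHS]mulr_natl ler_wpM2r ?sqr_ge0//.
by rewrite -natrX ler_nat; case: d x xle => // d _ _; rewrite -mulnn leq_pmulr.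
Qed.

Lemma similitude_inj (R : realType) (d : nat) (r : R)
    (f : 'rV[R]_d -> 'rV[R]_d) : 0 < r -> similitude r f -> injective f.
Proof.
move=> r0 rf x y fxy; apply/eqP; rewrite -subr_eq0 -normr_le0.
rewrite (le_trans (norm_le_enorm _))// -(pmulr_rle0 _ r0) -rf fxy subrr.
by rewrite (le_trans (enorm_le_norm _))// normr0 mulr0.
Qed.

Lemma similitude_continuous (R : realType) (d : nat) (r : R)
    (f : 'rV[R]_d -> 'rV[R]_d) : 0 < r -> similitude r f -> continuous f.
Proof.
move=> r0 rf x; apply/(@cvgrPdist_lt _ _ _ (nbhs x) (nbhs_filter x)) => e e0.
(* [d.+1] instead of [d] keeps [c] positive in dimension 0. *)
pose c := r * d.+1%:R; have c0 : 0 < c by rewrite mulr_gt0.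
near=> y.
apply: (@le_lt_trans _ _ (c * `|x - y|)).
  rewrite (le_trans (norm_le_enorm _))// rf -mulrA ler_wpM2l ?(ltW r0)//.
  by rewrite (le_trans (enorm_le_norm _))// ler_wpM2r// ler_nat.
rewrite mulrC -ltr_pdivlMr//; near: y.
by move: (e / c) (divr_gt0 e0 c0); apply/cvgrPdist_lt; exact: cvg_id.
Unshelve. all: by end_near. Qed.

(** * Compositions and one-step successors *)

Lemma compositions_similitude (R : realType) (d : nat) (r : R)
    (F : set ('rV[R]_d -> 'rV[R]_d)) (n : nat) (f : 'rV[R]_d -> 'rV[R]_d) :
  (forall f, F f -> similitude r f) -> compositions F n f ->
  similitude (r ^+ n) f.
Proof.
move=> rF; elim: n f => [f -> x y|n IHn _ [f [g [Ff Fg ->]]] x y] /=.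
  by rewrite expr0 mul1r.
by rewrite (rF _ Ff) (IHn _ Fg) exprS mulrA.
Qed.

(** [compositions] peels off the outermost map, whereas the descent along a chain of neighbor maps
    removes the innermost one. *)
Lemma compositionsSr (T : Type) (F : set (T -> T)) (n : nat) (h : T -> T) :
  compositions F n.+1 h ->
  exists f g, [/\ compositions F n f, F g & h = f \o g].
Proof.
elim: n h => [_ [f [g [Ff -> ->]]]|n IHn _ [f [g [Ff Fg ->]]]].
  by exists id, f.
have [f' [g' [Ff' Fg' ->]]] := IHn _ Fg.
by exists (f \o f'), g'; split => //; exists f, f'.
Qed.

(** Both [f] and [g] scale by [r ^+ n], and this common factor cancels. *)
Lemma lquotient_similitude1 (R : realType) (d : nat) (r : R)
    (F : set ('rV[R]_d -> 'rV[R]_d)) (n : nat)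
    (f g h : 'rV[R]_d -> 'rV[R]_d) :
  0 < r -> (forall f, F f -> similitude r f) -> compositions F n f ->
  compositions F n g -> f \o h = g -> similitude 1 h.
Proof.
move=> r0 rF Ff Fg fhg x y; rewrite mul1r.
have rn0 : r ^+ n != 0 by rewrite gt_eqF// exprn_gt0.
apply: (mulfI rn0).
rewrite -(compositions_similitude rF Ff).
by rewrite -(compositions_similitude rF Fg) -fhg.
Qed.

(* [f] and [g] need not be invertible here, so [h' = f^-1 h g] is stated as
   [f h' = h g]. *)
Definition successors (T : Type) (F S : set (T -> T)) : set (T -> T) :=
  \bigcup_(h in S) \bigcup_(f in F) \bigcup_(g in F)
    [set h' | f \o h' = h \o g].

(** Since [f] is injective, each triple [h], [f], [g] determines at most one successor. *)
Lemma finite_successors (T : Type) (F S : set (T -> T)) :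
  finite_set F -> (forall f, F f -> injective f) -> finite_set S ->
  finite_set (successors F S).
Proof.
move=> finF injF finS; apply: bigcup_finite => // h _.
apply: bigcup_finite => // f Ff; apply: bigcup_finite => // g _.
have [[h0 h0P]|noh] := pselect (exists h', f \o h' = h \o g).
  apply: (sub_finite_set _ (finite_set1 h0)) => h' /= h'P.
  apply/funext => x; apply: (injF _ Ff).
  by move/(congr1 (@^~ x)): h'P; move/(congr1 (@^~ x)): h0P => /= -> ->.
by apply: (sub_finite_set _ (finite_set0 _)) => h' h'P; apply: noh; exists h'.
Qed.

(** The distance from [a] to [h b] attains its minimum on the compact set [A * A], and this minimum
    is nonzero by disjointness. It is taken in the sup norm, which the Euclidean norm dominates. *)
Lemma separated (R : realType) (d : nat) (A : set 'rV[R]_d)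
    (h : 'rV[R]_d -> 'rV[R]_d) :
  A !=set0 -> compact A -> continuous h -> ~ (A `&` h @` A !=set0) ->
  exists2 e : R, 0 < e & forall a b, A a -> A b -> e <= enorm (a - h b).
Proof.
move=> [a0 Aa0] cA ch dis.
pose p (x : 'rV[R]_d * 'rV[R]_d) : R := `|x.1 - h x.2|.
have cp : continuous p.
  move=> x; apply: cvg_norm; apply: cvgB; first exact: cvg_fst.
  by apply: (continuous_comp (f := snd)); [exact: cvg_snd|exact: ch].
have [|[a b]] :=
  compact_EVT_min _ (compact_setX cA cA) (continuous_subspaceT cp).
  by exists (a0, a0).
rewrite inE => -[/= Aa Ab] minp; exists (p (a, b)).
  rewrite normr_gt0 subr_eq0; apply/eqP => /= ahb.
  by apply: dis; exists a; split => //; exists b.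
move=> x y Ax Ay; apply: le_trans (norm_le_enorm _).
by apply: (minp (x, y)); rewrite inE.
Qed.

(** From [f h' = h g] follows [r * enorm (a - h' b) = enorm (f a - h (g b))] with [f a] and [g b]
    again in [A], so each step gains a factor [1 / r]. *)
Lemma successors_separated (R : realType) (d : nat) (r : R)
    (F S : set ('rV[R]_d -> 'rV[R]_d)) (A : set 'rV[R]_d) (e : R)
    (m : nat) :
  0 < r -> (forall f, F f -> similitude r f) ->
  (forall f a, F f -> A a -> A (f a)) ->
  (forall h a b, S h -> A a -> A b -> e <= enorm (a - h b)) ->
  forall h a b, iter m (successors F) S h -> A a -> A b ->
    e <= r ^+ m * enorm (a - h b).
Proof.
move=> r0 rF FA sepS; elim: m => [|m IHm] h a b.
  by rewrite expr0 mul1r; exact: sepS.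
move=> [h' h'S [f Ff [g Fg /= fh]]] Aa Ab.
rewrite exprSr -mulrA -(rF _ Ff).
by have := congr1 (@^~ b) fh => /= ->; apply: IHm => //; exact: FA.
Qed.

(** Once [r ^+ m * |E| < e], no descendant of depth [m] is near; the finitely many smaller depths
    contribute finite sets. *)
Lemma finite_near_descendants (R : realType) (d : nat) (r : R)
    (F S : set ('rV[R]_d -> 'rV[R]_d)) (A : set 'rV[R]_d) (e E : R) :
  0 < r < 1 -> finite_set F -> (forall f, F f -> similitude r f) ->
  (forall f a, F f -> A a -> A (f a)) -> finite_set S -> 0 < e ->
  (forall h a b, S h -> A a -> A b -> e <= enorm (a - h b)) ->
  finite_set [set h | (exists m, iter m (successors F) S h) /\
                      exists a b, [/\ A a, A b & enorm (a - h b) <= E]].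
Proof.
move=> /andP[r0 r1] finF rF FA finS e0 sepS.
have [N _ rN] : \forall m \near \oo, r ^+ m * `|E| < e.
  have : (fun m => r ^+ m * `|E|) @ \oo --> 0 * `|E|.
    by apply: cvgMl; apply: cvg_expr; rewrite gtr0_norm.
  by rewrite mul0r => /cvgr_lt; apply.
apply: (@sub_finite_set _ _ (\bigcup_(m in `I_N) iter m (successors F) S)).
  move=> h [[m hm] [a [b [Aa Ab hE]]]]; exists m => //=.
  rewrite ltnNge; apply/negP => /rN /=.
  apply/negP; rewrite -leNgt.
  rewrite (le_trans (successors_separated r0 rF FA sepS hm Aa Ab))//.
  by rewrite ler_wpM2l ?exprn_ge0 ?(ltW r0)// (le_trans hE)// ler_norm.
apply: bigcup_finite => [|m _]; first exact: finite_II.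
elim: m {rN} => //= m IHm; apply: finite_successors => // f Ff.
exact: similitude_inj r0 (rF _ Ff).
Qed.

(** The proof takes for [k] the first improper map of the chain, and [m] counts the steps from [k]
    to [h]. The start [id] is put into [U] by hand because [neighbor_maps] asks for [1 <= n]. *)
Lemma neighbor_map_descent (R : realType) (d : nat) (r : R)
    (F : set ('rV[R]_d -> 'rV[R]_d)) (A : set 'rV[R]_d) (n : nat)
    (f g h : 'rV[R]_d -> 'rV[R]_d) :
  let U := [set id] `|` [set h | neighbor_maps F h /\ A `&` h @` A !=set0] in
  0 < r -> (forall f, F f -> similitude r f) ->
  compositions F n f -> compositions F n g -> is_lquotient f g h ->
  U h \/ exists k m, [/\ successors F U k, similitude 1 k,
    ~ (A `&` k @` A !=set0) & iter m (successors F) [set k] h].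
Proof.
move=> U r0 rF; elim: n f g h => [|n IHn] f g h.
  by move=> -> -> [k [fk kf ->]]; left; left; apply/funext => x; exact: fk x.
move=> cf cg q.
have h1 : similitude 1 h.
  have [fi [ffi fif hE]] := q.
  apply: (lquotient_similitude1 r0 rF cf cg).
  by rewrite hE; apply/funext => x /=; rewrite fif.
have hN : neighbor_maps F h by exists n.+1, f, g.
have [f' [f1 [cf' Ff1 fE]]] := compositionsSr cf.
have [g' [g1 [cg' Fg1 gE]]] := compositionsSr cg.
have [fi [ffi fif hE]] := q.
have f'inj : injective f'.
  apply: (similitude_inj _ (compositions_similitude rF cf')).
  exact: exprn_gt0.
(* The inverse of [f = f' f1] yields a right inverse of [f'], which is two-sided because [f'] is
   injective. *)
have f'K : cancel (f1 \o fi) f' by move=> x; rewrite -[RHS]fif fE.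
have Kf' : cancel f' (f1 \o fi) by move=> x; apply: f'inj; rewrite f'K.
pose h' := (f1 \o fi) \o g'.
have q' : is_lquotient f' g' h' by exists (f1 \o fi).
have hh' : f1 \o h = h' \o g1.
  by rewrite hE /h' gE.
have [Uh'|[k [m [sk k1 kA hk]]]] := IHn _ _ _ cf' cg' q'; last first.
  right; exists k, m.+1; split => //=.
  by exists h' => //; exists f1 => //; exists g1.
have [hA|hA] := pselect (A `&` h @` A !=set0); first by left; right.
right; exists h, 0%N; split => //.
by exists h' => //; exists f1 => //; exists g1.
Qed.

Lemma finite_near_neighbor_maps (R : realType) (d : nat) (r : R)
    (F : set ('rV[R]_d -> 'rV[R]_d)) (A : set 'rV[R]_d) (E : R) :
  0 < r < 1 -> is_ifs r F -> is_attractor F A -> finite_type F A ->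
  finite_set [set h | neighbor_maps F h /\
                      exists a b, [/\ A a, A b & enorm (a - h b) <= E]].
Proof.
move=> /[dup] r01 /andP[r0 r1] [finF rF] [A0 cA AE] ft.
have FA f a : F f -> A a -> A (f a).
  by move=> Ff Aa; rewrite AE; exists f => //; exists a.
set U := [set id] `|` [set h | neighbor_maps F h /\ A `&` h @` A !=set0].
have finU : finite_set U.
  by rewrite finite_setU; split; [exact: finite_set1|exact: ft].
pose near k := [set h | (exists m, iter m (successors F) [set k] h) /\
                      exists a b, [/\ A a, A b & enorm (a - h b) <= E]].
pose I := [set k | [/\ successors F U k, similitude 1 k &
                       ~ (A `&` k @` A !=set0)]].
apply: (@sub_finite_set _ _ (U `|` \bigcup_(k in I) near k)).
  move=> h [[n [f [g [_ cf cg q]]]] hE].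
  have [Uh|[k [m [sk k1 kA hk]]]] :=
    neighbor_map_descent A r0 rF cf cg q; first by left.
  by right; exists k => //; split => //; exists m.
rewrite finite_setU; split => //; apply: bigcup_finite.
  apply: (@sub_finite_set _ _ (successors F U)); first by move=> k [].
  apply: finite_successors => // f Ff.
  exact: similitude_inj r0 (rF _ Ff).
(* The separation [e] depends on [k], so the descendants are counted for one [k] at a time. *)
move=> k [_ k1 kA].
have [e e0 sep] := separated A0 cA (similitude_continuous ltr01 k1) kA.
apply: (finite_near_descendants _ r01 finF rF FA _ e0) => //.
by move=> _ a b ->; exact: sep.
Qed.

Lemma bounded_set_le (R : realType) (V : normedModType R) (B : set V) :
  bounded_set B -> exists M : R, forall x, B x -> `|x| <= M.
Proof.
by move=> [M [_ MB]]; exists (M + 1) => x; apply: MB; rewrite ltrDl.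
Qed.

(** Common source of both claims: the first takes [B = {0}], where [h 0 = v]; the second takes
    [B = V] and [D = 0]. *)
Lemma finite_bounded_neighbor_maps (R : realType) (d : nat) (r : R)
    (F : set ('rV[R]_d -> 'rV[R]_d)) (A B : set 'rV[R]_d) (D : R) :
  0 < r < 1 -> is_ifs r F -> is_attractor F A -> finite_type F A ->
  bounded_set B ->
  finite_set [set h | neighbor_maps F h /\
                      exists x y, [/\ B x, B y & enorm (x - h y) <= D]].
Proof.
move=> /[dup] r01 /andP[r0 r1] /[dup] Fifs [_ rF] hA ft.
move=> /bounded_set_le[M BM].
have [[a0 Aa0] /compact_bounded/bounded_set_le[L AL] _] := hA.
(* Triangle inequality along [a0], [x], [h y], [h a0]; each factor [d] comes from passing from the
   sup norm to the Euclidean one. *)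
pose E : R := d%:R * (L + M + D + (d%:R * (M + L))).
apply: (sub_finite_set _ (finite_near_neighbor_maps E r01 Fifs hA ft)).
move=> h [/[dup] hN [n [f [g [_ cf cg [fi [ffi fif hE]]]]]] [x [y [Bx By xy]]]].
split => //; exists a0, a0; split => //.
have h1 : similitude 1 h.
  apply: (lquotient_similitude1 r0 rF cf cg).
  by rewrite hE; apply/funext => z /=; rewrite fif.
rewrite (le_trans (enorm_le_norm _))// ler_wpM2l//.
have -> : a0 - h a0 = (a0 - x) + (x - h y) + (h y - h a0).
  by rewrite !subrKA.
rewrite (le_trans (ler_normD _ _))// lerD//.
  rewrite (le_trans (ler_normD _ _))// lerD//.
    by rewrite (le_trans (ler_normB _ _))// lerD ?AL ?BM.
  exact: le_trans (norm_le_enorm _) xy.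
rewrite (le_trans (norm_le_enorm _))// h1 mul1r.
rewrite (le_trans (enorm_le_norm _))// ler_wpM2l//.
by rewrite (le_trans (ler_normB _ _))// lerD ?AL ?BM.
Qed.

Theorem theorem6 (R : realType) (d : nat) (r : R)
    (F : set ('rV[R]_d -> 'rV[R]_d)) (A : set 'rV[R]_d)
    (hr0 : 0 < r) (hr1 : r < 1) (hF : is_ifs r F) (hA : is_attractor F A) :
  (finite_type F A ->
     forall D : R, 0 < D ->
       finite_set [set h | neighbor_maps F h /\
         exists (s : {linear 'rV[R]_d -> 'rV[R]_d}) (v : 'rV[R]_d),
           [/\ linear_isometry s, h = (fun x => s x + v) & enorm v <= D]])
  /\
  (forall V : set 'rV[R]_d, open V -> A `<=` V ->
     (forall f, F f -> f @` V `<=` V) ->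
     (ngai_wang F V -> finite_type F A) /\
     (bounded_set V -> (finite_type F A <-> ngai_wang F V))).
Proof.
have r01 : 0 < r < 1 by rewrite hr0.
split=> [ft D _|V _ AV _].
  have B0 : bounded_set [set 0 : 'rV[R]_d].
    by exists 0; split => // M M0 _ /= ->; rewrite normr0 ltW.
  apply: (sub_finite_set _
    (finite_bounded_neighbor_maps D r01 hF hA ft B0)).
  move=> h [hN [s [v [_ hE vD]]]]; split => //; exists 0, 0; split => //.
  rewrite hE linear0 add0r sub0r; move: vD; rewrite /enorm.
  by under [X in _ -> Num.sqrt X <= _]eq_bigr do rewrite mxE sqrrN.
(* A point [x = h y] of [A] with [y] in [A] gives [f x = g y], a common point of [f V] and [g V]. *)
have nw_ft : ngai_wang F V -> finite_type F A.
  apply: sub_finite_set => h [[n [f [g [n1 cf cg q]]]] [x [Ax [y Ay hy]]]].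
  have [fi [_ fif hE]] := q.
  exists n, f, g; split => //; exists (f x); split.
    by exists x => //; exact: AV.
  by exists y; [exact: AV|rewrite -hy hE /= fif].
split => // bV; split => // ft.
apply: (sub_finite_set _
  (finite_bounded_neighbor_maps 0 r01 hF hA ft bV)).
(* Conversely, [f x = g y] with [x] and [y] in [V] means [x = h y], at distance 0. *)
move=> h [n [f [g [n1 cf cg [_ [[x Vx <-] [y Vy gy]]] q]]]].
split; first by exists n, f, g.
exists x, y; split => //; have [fi [ffi _ ->]] := q.
by rewrite /= gy ffi subrr (le_trans (enorm_le_norm _))// normr0 mulr0.
Qed.
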